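(* For bivariate copulas $D_n$ ($n\in\mathbb{N}$) and $D$, consider: (i) $D_n\xrightarrow{\partial_2}D$; (ii) $\mathcal{T}(D_n)\xrightarrow{\partial_2}\mathcal{T}(D)$; (iii) $\mathcal{T}(D_n)\to\mathcal{T}(D)$ uniformly on $[0,1]^2$; (iv) $\mathcal{T}^2(D_n)\xrightarrow{\partial_2}\mathcal{T}^2(D)$; (v) $\mathcal{T}^2(D_n)\to\mathcal{T}^2(D)$ uniformly on $[0,1]^2$. Then (i) implies (ii), and (ii), (iii), (iv), (v) are equivalent.
   Context: $\Pi(u,v)=uv$; $\partial_2$ the partial derivative in the second argument; $D\vee E(u,v):=\int_0^1\min\{\partial_2D(u,t),\partial_2E(v,t)\}\,dt$; $\mathcal{T}(C):=C\vee\Pi$, $\mathcal{T}^2=\mathcal{T}\circ\mathcal{T}$. $D_n\xrightarrow{\partial_2}D$ means $\int_0^1|\partial_2D_n(u,t)-\partial_2D(u,t)|\,dt\to0$ for all $u\in[0,1]$. *)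

(* Defs.v *)
From HB Require Import structures.
From mathcomp Require Import all_boot all_order all_algebra.
From mathcomp Require Import all_classical all_reals all_analysis.
Set Implicit Arguments. Unset Strict Implicit. Unset Printing Implicit Defensive.
Import Order.TTheory GRing.Theory Num.Theory.
Import numFieldNormedType.Exports.
Local Open Scope classical_set_scope.
Local Open Scope ring_scope.

Section Copulas.
Variable R : realType.

(** A bivariate copula, given as a function R -> R -> R of which only the
    restriction to [0,1]^2 matters. *)
Definition is_copula (C : R -> R -> R) : Prop :=
  [/\ (forall u, 0 <= u <= 1 -> C u 0 = 0 /\ C 0 u = 0),
      (forall u, 0 <= u <= 1 -> C u 1 = u /\ C 1 u = u)
    & (forall u1 u2 v1 v2, 0 <= u1 -> u1 <= u2 -> u2 <= 1 ->
         0 <= v1 -> v1 <= v2 -> v2 <= 1 ->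
         0 <= C u2 v2 - C u2 v1 - C u1 v2 + C u1 v1)].

Definition I01 : set R := `[(0:R), (1:R)].

Definition Pi (u v : R) : R := u * v.

(** partial derivative in the second argument (derive1 is total: where the
    derivative does not exist it takes an unspecified value; this only
    matters on a Lebesgue-null set of t). *)
Definition d2 (C : R -> R -> R) (u t : R) : R := derive1 (fun s => C u s) t.

Definition cjoin (D E : R -> R -> R) (u v : R) : R :=
  Rintegral (@lebesgue_measure R) I01 (fun t => Num.min (d2 D u t) (d2 E v t)).

Definition Top (C : R -> R -> R) : R -> R -> R := cjoin C Pi.
Definition Top2 (C : R -> R -> R) : R -> R -> R := Top (Top C).

Definition d2_dist (F G : R -> R -> R) (u : R) : \bar R :=
  (\int[@lebesgue_measure R]_(t in I01) (`|d2 F u t - d2 G u t|)%:E)%E.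

Definition d2_cvg (Dn : nat -> R -> R -> R) (D : R -> R -> R) : Prop :=
  forall u, 0 <= u <= 1 -> (fun n => d2_dist (Dn n) D u) @ \oo --> (0 : \bar R)%E.

Definition unif_cvg (Fn : nat -> R -> R -> R) (F : R -> R -> R) : Prop :=
  forall e : R, 0 < e -> exists N : nat, forall n, (N <= n)%N ->
    forall u v, 0 <= u <= 1 -> 0 <= v <= 1 -> `|Fn n u v - F u v| < e.

End Copulas.

(* Main.v *)
Require Import Defs.
From HB Require Import structures.
From mathcomp Require Import all_boot all_order all_algebra.
From mathcomp Require Import all_classical all_reals all_analysis.
From mathcomp Require Import measurable_realfun ring lra.
(* For a copula C, the section C(u,.) is monotone and 1-Lipschitz, so it has a
   density f with values in [0,1] (Radon-Nikodym for its Stieltjes measure, then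
   Lebesgue differentiation), and phi(v) := T(C)(u,v) = \int min(f,v) is concave,
   with supergradient |{f > s}| at s.
   - L1 convergence of the densities gives pointwise convergence of T(D_n),
     because f |-> \int min(f,v) is an L1 contraction.
   - Pointwise convergence of concave functions gives convergence of the
     derivatives wherever the limit is differentiable, hence L1 convergence by
     dominated convergence.
   - Pointwise and uniform convergence agree for copulas (equi-Lipschitz), and
     T(C) is again a copula, so the same facts apply to T^2 = T o T.
   - T^2(C)(u,.) is, up to constants, the concave conjugate of T(C)(u,.); as
     conjugation is an involution and a sup-norm contraction, uniform
     convergence of T^2(D_n) implies that of T(D_n).
   Partial derivatives are only controlled almost everywhere and their
   measurability is not available, hence the almost-everywhere congruence of
   integrals of arbitrary functions. *)

Set Implicit Arguments.
Unset Strict Implicit.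
Unset Printing Implicit Defensive.
Import Order.TTheory GRing.Theory Num.Theory.
Import numFieldNormedType.Exports.
Local Open Scope classical_set_scope.
Local Open Scope ring_scope.

(** * Integrals of arbitrary functions modulo null sets *)

Section ae_eq_integral_any.
Context d (T : measurableType d) (R : realType).
Variable mu : {measure set T -> \bar R}.
Local Open Scope ereal_scope.
Import HBNNSimple.

(** The integral of a nonnegative function, measurable or not, is a supremum over the simple
    functions below it. A simple [h] below [f] is multiplied by the indicator of the complement of
    [N]: the product lies below [g] and has the same integral as [h]. *)
Lemma ge0_integral_le_off_null (N : set T) (f g : T -> \bar R) :
  measurable N -> mu N = 0 -> (forall x, 0 <= f x) -> (forall x, 0 <= g x) ->
  (forall x, ~ N x -> f x <= g x) ->
  \int[mu]_x f x <= \int[mu]_x g x.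
Proof.
move=> mN N0 f0 g0 fg; rewrite !ge0_integralTE//.
apply: ge_ereal_sup => _ [h/= hf] <-.
have mNC : measurable (~` N) by exact: measurableC.
apply: le_ereal_sup_tmp; exists (sintegral mu (proj_nnsfun h mNC)).
  exists (proj_nnsfun h mNC) => //= x.
  rewrite mindicE; case: (boolP (x \in ~` N)) => [|_].
    by rewrite inE => xN; rewrite mulr1; exact: le_trans (hf x) (fg _ xN).
  by rewrite mulr0.
rewrite -!integralT_nnsfun.
rewrite (ge0_ae_eq_integral measurableT (f := fun x => (h x)%:E)
  (g := fun x => (proj_nnsfun h mNC x)%:E))//.
- exact/measurable_EFinP.
- exact/measurable_EFinP.
- by move=> x _; rewrite lee_fin.
- by move=> x _; rewrite lee_fin.
- exists N; split => // x /= /not_implyP[_]; apply: contra_notP => xN.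
  by rewrite /= mindicE mem_set// mulr1.
Qed.

(** The previous comparison is used in both directions on positive and negative parts, after
    extension by zero outside [D]. *)
Lemma ae_eq_integral_any (D : set T) (f g : T -> \bar R) :
  ae_eq mu D f g -> \int[mu]_(x in D) f x = \int[mu]_(x in D) g x.
Proof.
case=> N [mN N0 sub].
have E x : ~ N x -> (f \_ D) x = (g \_ D) x.
  move=> Nx; rewrite !patchE; case: ifPn => // /set_mem Dx.
  by apply: contrapT => fgx; apply: Nx; apply: sub => /= /(_ Dx).
have le0 (h k : T -> \bar R) : (forall x, 0 <= h x) -> (forall x, 0 <= k x) ->
    (forall x, ~ N x -> h x = k x) -> \int[mu]_x h x = \int[mu]_x k x.
  by move=> h0 k0 hk; apply/eqP; rewrite eq_le; apply/andP; split;
    apply: (ge0_integral_le_off_null mN N0) => // x /hk ->.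
rewrite integral_mkcond [RHS]integral_mkcond integralE [RHS]integralE.
by congr (_ - _); apply: le0 => // x /E; rewrite ?funeposE ?funenegE => ->.
Qed.

End ae_eq_integral_any.

(** * Radon-Nikodym densities of Stieltjes measures dominated by Lebesgue measure *)

Section lipschitz_density.
Context {R : realType}.
Notation mu := (@lebesgue_measure R).

Lemma lebesgue_stieltjes_measure_ocitv (F : cumulative R R) (a b : R) : a <= b ->
  lebesgue_stieltjes_measure F `]a, b]%classic = (F b - F a)%:E.
Proof.
move=> ab; rewrite /lebesgue_stieltjes_measure /measure_extension/=.
by rewrite measurable_mu_extE/= ?wlength_itv_bnd//; exact: is_ocitv.
Qed.

Section cumulative_sum.
Variables F G : cumulative R R.
Hypothesis FG : forall x, F x + G x = x.

(** On half-open intervals the increments of [F] and [G] add up to the length; uniqueness of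
    Lebesgue measure extends this to all measurable sets. *)
Lemma lebesgue_stieltjes_measure_sum (A : set (measurableTypeR R)) : measurable A ->
  mu A = (lebesgue_stieltjes_measure F A + lebesgue_stieltjes_measure G A)%E.
Proof.
move=> mA.
apply: etrans (measure_addE _ _ _).
apply: lebesgue_measure_unique => // X [[a b] _ <-] /=.
apply: etrans (esym (measure_addE _ _ _)).
have [ab|ba] := leP a b; last first.
  by rewrite set_itv_ge ?bnd_simp -?leNgt ?ltW// !measure0 adde0.
rewrite -[RHS]/(lebesgue_stieltjes_measure F `]a, b]%classic +
  lebesgue_stieltjes_measure G `]a, b]%classic)%E.
rewrite /lebesgue_measure !lebesgue_stieltjes_measure_ocitv// -EFinD.
congr EFin; rewrite -[LHS]/(b - a) -[in LHS](FG b) -[in X in _ - X](FG a).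
by rewrite opprD addrACA.
Qed.

(** The measure of [G] is nonnegative, so the measure of [F] is at most Lebesgue measure, hence
    absolutely continuous. *)
Lemma lebesgue_stieltjes_density : exists f : R -> R,
  mu.-integrable setT (EFin \o f) /\
  forall v, 0 <= v <= 1 -> F v - F 0 = \int[mu]_(t in `[0, v]) f t.
Proof.
pose nu0 := lebesgue_stieltjes_measure F.
(* Restriction to ]0, 1] makes the measure finite and keeps the increments of [F] on [0, 1]. *)
pose I : set (measurableTypeR R) := `](0:R), 1]%classic.
have mI : measurable I by exact: (measurable_itv `](0:R), 1]).
have nuy : (nu0 I < +oo)%E.
  by rewrite /nu0 lebesgue_stieltjes_measure_ocitv ?ltry.
pose nu : {finite_measure set (measurableTypeR R) -> \bar R} := mfrestr mI nuy.
have dom : nu `<< mu.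
  apply/null_content_dominatesP => A mA muA; apply/eqP.
  rewrite -measure_le0 -[leRHS]muA [leRHS](lebesgue_stieltjes_measure_sum mA).
  rewrite -[leLHS]adde0; apply: leeD; last exact: measure_ge0.
  by rewrite /nu/= /mfrestr /mrestr le_measure ?inE//; exact: measurableI.
pose g := Radon_Nikodym (charge_of_finite_measure nu) mu.
have gint : mu.-integrable setT g.
  exact: (@Radon_Nikodym_integrable _ _ _ (charge_of_finite_measure nu) mu dom).
have gE A : measurable A -> nu A = (\int[mu]_(x in A) g x)%E.
  exact: (@Radon_Nikodym_integral _ _ _ (charge_of_finite_measure nu) mu A dom).
have gfin x : g x \is a fin_num by exact: Radon_Nikodym_fin_num.
exists (fine \o g); split.
  have -> : EFin \o (fine \o g) = g by apply/funext => x /=; rewrite fineK.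
  exact: gint.
move=> v /andP[v0 v1].
rewrite /Rintegral.
under eq_integral do rewrite fineK//.
(* Stieltjes measures are evaluated on half-open intervals; the endpoint 0 is Lebesgue-null. *)
rewrite -integral_itv_obnd_cbnd; last first.
  apply: measurable_funTS; exact: (measurable_int mu gint).
apply: etrans (congr1 fine (gE _ (measurable_itv `](0:R), v]))).
rewrite /nu/= /mfrestr /mrestr/= setIidl.
  by rewrite /nu0 lebesgue_stieltjes_measure_ocitv.
by move=> x/=; rewrite /I /= !in_itv/= => /andP[-> /le_trans->//].
Qed.

End cumulative_sum.

End lipschitz_density.

(** * Comparison of derivatives through increments *)

Section derivatives.
Context {R : realType}.
Implicit Types (F G : R -> R) (t : R).

Lemma derivable_eps F t : derivable F t 1 -> forall e, 0 < e ->
  exists2 d, 0 < d & forall h, `|h| < d ->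
    `|F (t + h) - F t - derive1 F t * h| <= e * `|h|.
Proof.
move=> dF e e0.
have H : h^-1 *: (F (h + t) - F t) @[h --> 0^'] --> derive1 F t.
  rewrite derive1E /derive.
  have /cvg_ex[l] := dF.
  have -> : (fun h : R => h^-1 *: (F (h *: (1:R) + t) - F t)) =
            (fun h : R => h^-1 *: (F (h + t) - F t)).
    by apply/funext => h; rewrite [_ *: 1]mulr1.
  by move=> hl; have -> := cvg_lim _ hl.
move/cvgrPdist_lt : H => /(_ _ e0) [d /= d0 H].
exists d => // h hd.
have [->|h0] := eqVneq h 0.
  by rewrite addr0 subrr mulr0 subr0 normr0 mulr0.
have := H h; rewrite /ball_ /= sub0r normrN => /(_ hd h0) /ltW.
rewrite distrC -(ler_pM2r (_ : 0 < `|h|)) ?normr_gt0// -normrM mulrBl.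
by rewrite -[_ *: _]/(_ * _) mulrAC mulVf// mul1r [h + t]addrC.
Qed.

(** The factor [h] lets one hypothesis cover increments on both sides. If the conclusion failed by
    [4 * e], two first-order errors of at most [e * (h * h)] each could not fill a gap of
    [4 * (e * (h * h))]. *)
Lemma derive1_le F G t : derivable F t 1 -> derivable G t 1 ->
  (forall d, 0 < d -> exists h, [/\ h != 0, `|h| < d &
     h * (F (t + h) - F t) <= h * (G (t + h) - G t)]) ->
  derive1 F t <= derive1 G t.
Proof.
move=> dF dG FG; rewrite leNgt; apply/negP => GF.
pose e := (derive1 F t - derive1 G t) / 4.
have e0 : 0 < e by rewrite /e; lra.
have [d1 d10 H1] := derivable_eps dF e0.
have [d2 d20 H2] := derivable_eps dG e0.
have [|h [h0 hd FGh]] := FG (Num.min d1 d2); first by rewrite lt_min d10.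
move: hd; rewrite lt_min => /andP[/H1 {}H1 /H2 {}H2].
have hh : 0 < h * h by rewrite -expr2 lt_neqAle sqr_ge0 eq_sym sqrf_eq0 h0.
have {}H1 : `|h * (F (t + h) - F t - derive1 F t * h)| <= e * (h * h).
  rewrite normrM -[h * h]gtr0_norm// [`|h * h|]normrM mulrCA.
  by rewrite ler_wpM2l.
have {}H2 : `|h * (G (t + h) - G t - derive1 G t * h)| <= e * (h * h).
  rewrite normrM -[h * h]gtr0_norm// [`|h * h|]normrM mulrCA.
  by rewrite ler_wpM2l.
move: H1 H2; rewrite !ler_norml => /andP[H1 _] /andP[_ H2].
have : 0 < e * (h * h) by rewrite mulr_gt0.
have : (derive1 F t - derive1 G t) * (h * h) = 4 * (e * (h * h)).
  by rewrite /e; field.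
move: (e * (h * h)) H1 H2 => x; rewrite !mulrBr !mulrBl.
have -> : h * (derive1 F t * h) = derive1 F t * (h * h) by ring.
have -> : h * (derive1 G t * h) = derive1 G t * (h * h) by ring.
move: FGh; rewrite !mulrBr; lra.
Qed.

Lemma is_derive_scale (c t : R) : is_derive t 1 ( *%R c) c.
Proof.
have := @is_deriveZ R R R id c t 1 1 (is_derive_id _ _).
by rewrite [_ *: _]mulr1.
Qed.

Lemma derive1_scale (c t : R) : derive1 ( *%R c) t = c.
Proof. by rewrite derive1E (@derive_val _ _ _ _ _ _ _ (is_derive_scale c t)). Qed.

Lemma small_pos (d d' : R) : 0 < d -> 0 < d' ->
  exists h, [/\ 0 < h, h < d & h < d'].
Proof.
move=> d0 d'0; have [dd|dd] := leP d d'.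
  by exists (d / 2); split; lra.
by exists (d' / 2); split; lra.
Qed.

Lemma derive1_le_right F t (c d : R) : derivable F t 1 -> 0 < d ->
  (forall h, 0 < h < d -> F (t + h) - F t <= c * h) -> derive1 F t <= c.
Proof.
move=> dF d0 H; rewrite -[leRHS](derive1_scale c t).
apply: derive1_le => // d' d'0.
have [h [h0 hd hd']] := small_pos d0 d'0; exists h.
split; [by rewrite gt_eqF|by rewrite gtr0_norm|].
rewrite ler_pM2l//; apply: (le_trans (H _ _)); first by rewrite h0.
by rewrite mulrDr addrAC subrr add0r.
Qed.

Lemma derive1_ge_right F t (c d : R) : derivable F t 1 -> 0 < d ->
  (forall h, 0 < h < d -> c * h <= F (t + h) - F t) -> c <= derive1 F t.
Proof.
move=> dF d0 H; rewrite -[leLHS](derive1_scale c t).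
apply: derive1_le => // d' d'0.
have [h [h0 hd hd']] := small_pos d0 d'0; exists h.
split; [by rewrite gt_eqF|by rewrite gtr0_norm|].
rewrite ler_pM2l//; apply: (le_trans _ (H _ _)); last by rewrite h0.
by rewrite mulrDr addrAC subrr add0r.
Qed.

(** Right increments bound the derivative by [s] from above, left increments from below. *)
Lemma derive1_supergradient F t s (d : R) : derivable F t 1 -> 0 < d ->
  (forall h, `|h| < d -> F (t + h) - F t <= s * h) -> derive1 F t = s.
Proof.
move=> dF d0 H; apply/eqP; rewrite eq_le; apply/andP; split.
  by apply: (derive1_le_right dF d0) => h /andP[h0 hd]; rewrite H// gtr0_norm.
rewrite -[leLHS](derive1_scale s t).
apply: derive1_le => // d' d'0.
have [h [h0 hd hd']] := small_pos d0 d'0; exists (- h).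
split; [by rewrite oppr_eq0 gt_eqF|by rewrite normrN gtr0_norm|].
rewrite !mulNr lerN2 ler_pM2l//; apply: (le_trans (H _ _)).
  by rewrite normrN gtr0_norm.
by rewrite mulrDr addrAC subrr add0r.
Qed.

End derivatives.

(** * Densities of nondecreasing 1-Lipschitz functions on [0, 1] *)

Section lipschitz.
Context {R : realType}.
Notation mu := (@lebesgue_measure R).
Implicit Types F f : R -> R.

Definition unit_fun f := measurable_fun setT f /\ forall t, 0 <= f t <= 1.

(** The derivative is prescribed on the open interval only, since nothing controls [F] outside
    [0, 1]. *)
Definition is_density F f := [/\ unit_fun f,
  (forall v, 0 <= v <= 1 -> F v - F 0 = \int[mu]_(t in `[0, v]) f t) &
  {ae mu, forall t, 0 < t < 1 -> derivable F t 1 /\ derive1 F t = f t}].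

Lemma derivable_offset F G (c t d : R) : 0 < d ->
  (forall x, `|t - x| < d -> F x = G x + c) ->
  derivable G t 1 -> derivable F t 1 /\ derive1 F t = derive1 G t.
Proof.
move=> d0 FG dG.
have dGc : is_derive t 1 (fun x => G x + c) (derive1 G t).
  have := @is_deriveD _ _ _ G (cst c) t 1 (derive1 G t) 0.
  rewrite addr0; apply.
  by rewrite derive1E; exact: DeriveDef.
have near : {near t, (fun x => G x + c) =1 F}.
  by exists d => //= x /= xd; rewrite FG.
have dF := near_eq_is_derive near dGc.
by split; [exact: ex_derive|rewrite derive1E derive_val].
Qed.

#[global] Instance lebesgue_ae_filter : Filter (nbhs (almost_everywhere mu)).
Proof. exact: (ae_filter_ringOfSetsType mu). Qed.

Lemma ae_neq (c : R) : {ae mu, forall t : R, t != c}.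
Proof.
exists [set c]; split => //; first exact: lebesgue_measure_set1.
by move=> t /= /negP; rewrite negbK => /eqP.
Qed.

Lemma ae_unit_itv (P : R -> Prop) :
  {ae mu, forall t, 0 < t < 1 -> P t} -> {ae mu, forall t, 0 <= t <= 1 -> P t}.
Proof.
apply: filterS3 (ae_neq 0) (ae_neq 1) => t t0 t1 + /andP[t0' t1'].
by apply; rewrite lt_neqAle eq_sym t0 t0'/= lt_neqAle t1 t1'.
Qed.

Section clamp.
Definition clamp (x : R) := Num.max 0 (Num.min x 1).

Lemma clamp_id x : 0 <= x <= 1 -> clamp x = x.
Proof.
by case/andP=> x0 x1; rewrite /clamp (min_idPl x1) (max_idPr x0).
Qed.

Lemma clamp01 x : 0 <= clamp x <= 1.
Proof. by rewrite /clamp le_max lexx/= ge_max ler01/= ge_min lexx orbT. Qed.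

Lemma clamp_lip x y : x <= y -> 0 <= clamp y - clamp x <= y - x.
Proof.
rewrite /clamp /Num.max /Num.min.
by do ![case: ifPn => //]; rewrite -?leNgt; lra.
Qed.
End clamp.

Section density.
Variable F : R -> R.
Hypothesis lipF : forall x y, 0 <= x -> x <= y -> y <= 1 -> 0 <= F y - F x <= y - x.

(** Constant continuation beyond [0, 1] makes [Fc] and its complement [Gc] nondecreasing and
    continuous on the whole line, so that both are cumulative functions. *)
Let Fc x := F (clamp x).
Let Gc x := x - Fc x.

Let lipFc x y : x <= y -> 0 <= Fc y - Fc x <= y - x.
Proof.
move=> /clamp_lip/andP[c0 c1].
have /andP[a0 a1] := clamp01 x; have /andP[b0 b1] := clamp01 y.
have := lipF a0 _ b1; rewrite -subr_ge0 => /(_ c0)/andP[h0 h1].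
by rewrite h0 (le_trans h1).
Qed.

Let nd_rc (H : R -> R) : (forall x y, x <= y -> 0 <= H y - H x <= y - x) ->
  nondecreasing H /\ (forall x, H @ at_right x --> H x).
Proof.
move=> lipH; split=> [x y xy|x].
  by have /andP[] := lipH _ _ xy; rewrite subr_ge0.
apply/cvgrPdist_lt => e e0; near=> y.
have xy : x <= y by near: y; exact: nbhs_right_ge.
have /andP[h0 h1] := lipH _ _ xy.
rewrite distrC ger0_norm//; apply: (le_lt_trans h1).
by rewrite ltrBlDr addrC; near: y; apply: nbhs_right_lt; rewrite ltrDl.
Unshelve. all: by end_near. Qed.

Let lipGc x y : x <= y -> 0 <= Gc y - Gc x <= y - x.
Proof. by move=> /lipFc; rewrite /Gc; lra. Qed.

Lemma density_exists : exists f, is_density F f.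
Proof.
have [ndF rcF] := nd_rc lipFc; have [ndG rcG] := nd_rc lipGc.
pose Fm := isCumulative.Build R _ R Fc ndF rcF.
pose Gm := isCumulative.Build R _ R Gc ndG rcG.
pose FF : cumulative R R := HB.pack Fc Fm.
pose GG : cumulative R R := HB.pack Gc Gm.
have [|g [intg gE]] := @lebesgue_stieltjes_density R FF GG.
  by move=> x /=; rewrite /Gc addrC subrK.
have Fg v : 0 <= v <= 1 -> F v - F 0 = \int[mu]_(t in `[0, v]) g t.
  by move=> v01; rewrite -gE//= /Fc !clamp_id// lexx ler01.
have aeF : {ae mu, forall t, 0 < t < 1 -> derivable F t 1 /\ derive1 F t = g t}.
  have intgS (A : set R) : measurable A -> mu.-integrable A (EFin \o g).
    by move=> mA; apply: integrableS intg.
  (* By Lebesgue differentiation the indefinite integral of [g] has derivative [g] almost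
     everywhere; near a point of ]0, 1[ it differs from [F] by the constant [F 0]. *)
  have := @FTC1 R g (BLeft 0) _ _.
  move=> /(_ (fun y => intgS _ (measurable_itv _))).
  move=> /(_ (open_integrable_locally openT intg)).
  apply: filterS => t /= H /andP[t0 t1].
  have [|dG <-] := H; first by rewrite lte_fin.
  have [d [d0 dt dt1]] := small_pos t0 (ltac:(by rewrite subr_gt0) : 0 < 1 - t).
  apply: (derivable_offset (c := F 0) d0) => // x.
  rewrite ltr_norml => /andP[h1 h2].
  by rewrite -Fg ?subrK//; apply/andP; split; lra.
(* Clamping puts the values in [0, 1] at every point. On ]0, 1[ it alters [g] only on a null set,
   since almost everywhere there [g] is a derivative of [F], which lies in [0, 1]. *)
pose f t := clamp (g t).
have mf : measurable_fun setT f.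
  apply: measurable_maxr => //; apply: measurable_minr => //.
  by apply/measurable_EFinP; exact: (measurable_int mu intg).
have gf : {ae mu, forall t, 0 < t < 1 -> g t = f t}.
  apply: filterS aeF => t H t01; have [dF gt] := H t01.
  rewrite /f clamp_id// -gt.
  have /andP[t0 t1] := t01; have t1' : 0 < 1 - t by rewrite subr_gt0.
  have B h : 0 < h < 1 - t -> 0 <= F (t + h) - F t <= h.
    move=> /andP[h0 h1]; have := lipF (x := t) (y := t + h).
    by rewrite [X in _ <= _ <= X]addrAC subrr add0r; apply; lra.
  apply/andP; split.
    apply: (derive1_ge_right dF t1') => h /B /andP[+ _].
    by rewrite mul0r.
  apply: (derive1_le_right dF t1') => h /B /andP[_ +].
  by rewrite mul1r.
exists f; split.
- by split=> // t; exact: clamp01.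
- move=> v v01; rewrite Fg//; congr fine.
  apply: ae_eq_integral => //.
  + apply/measurable_EFinP/measurable_funTS/measurable_EFinP.
    exact: (measurable_int mu intg).
  + by apply/measurable_EFinP/measurable_funTS.
  + apply: filterS (ae_unit_itv gf) => t H; rewrite /= in_itv/= => /andP[t0 tv].
    by rewrite H// t0 (le_trans tv)//; case/andP: v01.
- by apply: filterS2 aeF gf => t H1 H2 t01; have [? ->] := H1 t01; rewrite H2.
Qed.

End density.
End lipschitz.

(** * Integration of bounded measurable functions over [0, 1] *)

Section bounded_functions.
Context {R : realType}.
Notation mu := (@lebesgue_measure R).
Notation I := (@I01 R).
Implicit Types (f g h : R -> R) (s t v M : R).

Definition bounded_mfun f := measurable_fun setT f /\ exists M, forall t, `|f t| <= M.

Lemma unit_bounded f : unit_fun f -> bounded_mfun f.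
Proof.
case=> mf f01; split=> //; exists 1 => t.
by have /andP[h1 h2] := f01 t; rewrite ger0_norm.
Qed.

Lemma bounded_mfun_cst c : bounded_mfun (fun=> c).
Proof. by split=> //; exists `|c|. Qed.

Lemma boundedB f g : bounded_mfun f -> bounded_mfun g ->
  bounded_mfun (fun t => f t - g t).
Proof.
move=> [mf [M fM]] [mg [N gN]]; split; first exact: measurable_funB.
by exists (M + N) => t; rewrite (le_trans (ler_normB _ _))// lerD.
Qed.

Lemma boundedD f g : bounded_mfun f -> bounded_mfun g ->
  bounded_mfun (fun t => f t + g t).
Proof.
move=> [mf [M fM]] [mg [N gN]]; split; first exact: measurable_funD.
by exists (M + N) => t; rewrite (le_trans (ler_normD _ _))// lerD.
Qed.

Lemma boundedM f g : bounded_mfun f -> bounded_mfun g ->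
  bounded_mfun (fun t => f t * g t).
Proof.
move=> [mf [M fM]] [mg [N gN]]; split; first exact: measurable_funM.
by exists (M * N) => t; rewrite normrM ler_pM.
Qed.

Lemma bounded_norm f : bounded_mfun f -> bounded_mfun (fun t => `|f t|).
Proof.
move=> [mf [M fM]]; split; first exact: measurableT_comp.
by exists M => t; rewrite normr_id.
Qed.

Lemma bounded_min f g : bounded_mfun f -> bounded_mfun g ->
  bounded_mfun (fun t => Num.min (f t) (g t)).
Proof.
move=> [mf [M fM]] [mg [N gN]]; split; first exact: measurable_minr.
exists (Num.max M N) => t; rewrite le_max /Num.min.
by case: ifP => _; rewrite ?fM ?gN ?orbT.
Qed.

Lemma bounded_indic (A : set R) : measurable A -> bounded_mfun (\1_A).
Proof.
move=> mA; split; first exact: measurable_indic.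
by exists 1 => t; rewrite indicE; case: (_ \in _); rewrite ?normr1 ?normr0.
Qed.

Lemma measurable_I01 : measurable I. Proof. exact: measurable_itv. Qed.
#[local] Hint Resolve measurable_I01 : core.

Lemma I01_finite : (mu I < +oo)%E.
Proof. by rewrite /I01 lebesgue_measure_itv/= lte_fin ltr01 -EFinB ltry. Qed.

Lemma bounded_integrable f : bounded_mfun f -> mu.-integrable I (EFin \o f).
Proof.
move=> [mf [M fM]]; apply: measurable_bounded_integrable => //.
- exact: I01_finite.
- exact: measurable_funTS.
- exists M; split; first exact: num_real.
  by move=> x Mx t _; exact: le_trans (fM t) (ltW Mx).
Qed.

Lemma Rintegral_cst01 (c : R) : \int[mu]_(t in I) c = c.
Proof.
rewrite Rintegral_cst//= /I01 lebesgue_measure_itv/= lte_fin ltr01/=.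
by rewrite subr0 mulr1.
Qed.

(** Almost everywhere on [0, 1], [g - f] equals its absolute value, whose integral is
    nonnegative. *)
Lemma le_Rintegral01 f g : bounded_mfun f -> bounded_mfun g ->
  {ae mu, forall t, 0 <= t <= 1 -> f t <= g t} ->
  \int[mu]_(t in I) f t <= \int[mu]_(t in I) g t.
Proof.
move=> bf bg fg.
rewrite -subr_ge0 -RintegralB//; try exact: bounded_integrable.
rewrite [leRHS](_ : _ = \int[mu]_(t in I) `|g t - f t|).
  by apply: Rintegral_ge0.
congr fine; apply: ae_eq_integral_any; apply: filterS fg => t H.
by rewrite /I01/= in_itv/= => /H; rewrite -subr_ge0 => /ger0_norm ->.
Qed.

Lemma ler_Rintegral01 f g : bounded_mfun f -> bounded_mfun g ->
  (forall t, f t <= g t) ->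
  \int[mu]_(t in I) f t <= \int[mu]_(t in I) g t.
Proof.
by move=> bf bg fg; apply: le_Rintegral => //; exact: bounded_integrable.
Qed.

Lemma Rintegral01D f g : bounded_mfun f -> bounded_mfun g ->
  \int[mu]_(t in I) (f t + g t) = \int[mu]_(t in I) f t + \int[mu]_(t in I) g t.
Proof. by move=> bf bg; rewrite RintegralD//; exact: bounded_integrable. Qed.

Lemma Rintegral01B f g : bounded_mfun f -> bounded_mfun g ->
  \int[mu]_(t in I) (f t - g t) = \int[mu]_(t in I) f t - \int[mu]_(t in I) g t.
Proof. by move=> bf bg; rewrite RintegralB//; exact: bounded_integrable. Qed.

Lemma Rintegral01Zr f c : bounded_mfun f ->
  \int[mu]_(t in I) (f t * c) = (\int[mu]_(t in I) f t) * c.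
Proof. by move=> bf; rewrite RintegralZr//; exact: bounded_integrable. Qed.

Lemma norm_Rintegral01 f : bounded_mfun f ->
  `|\int[mu]_(t in I) f t| <= \int[mu]_(t in I) `|f t|.
Proof. by move=> bf; apply: le_normr_Rintegral => //; exact: bounded_integrable. Qed.

Lemma Rintegral_split f s : bounded_mfun f -> 0 <= s <= 1 ->
  \int[mu]_(t in I) f t =
  \int[mu]_(t in `[0, s]) f t + \int[mu]_(t in `]s, 1]) f t.
Proof.
move=> bf /andP[s0 s1]; have := bounded_integrable bf => intf.
by rewrite -(@Rintegral_itvB _ f (BLeft 0) (BRight 1) s)// addrC subrK.
Qed.

(** * Truncated integrals as concave functions of the truncation level *)

Definition capped f v : R := \int[mu]_(t in I) Num.min (f t) v.
Definition tail f s : R := \int[mu]_(t in I) \1_[set t | s < f t] t.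

Variable f : R -> R.
Hypothesis uf : unit_fun f.
Let bf : bounded_mfun f := unit_bounded uf.
Let bmin v : bounded_mfun (fun t => Num.min (f t) v).
Proof. by apply: bounded_min => //; exact: bounded_mfun_cst. Qed.
Let f0 t : 0 <= f t. Proof. by have /andP[] := uf.2 t. Qed.
Let f1 t : f t <= 1. Proof. by have /andP[] := uf.2 t. Qed.

Lemma measurable_tail s : measurable [set t | s < f t].
Proof.
have -> : [set t | s < f t] = setT `&` f @^-1` `]s, +oo[%classic.
  by rewrite setTI; apply/seteqP; split => t /=; rewrite in_itv/= andbT.
exact: uf.1.
Qed.
Let btail s : bounded_mfun (\1_[set t | s < f t]).
Proof. exact: bounded_indic (measurable_tail s). Qed.

Lemma capped0 : capped f 0 = 0.
Proof.
rewrite -[RHS](Rintegral_cst01 0); apply: eq_Rintegral => t _.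
by rewrite (min_idPr _).
Qed.

Lemma capped1 : capped f 1 = \int[mu]_(t in I) f t.
Proof. by apply: eq_Rintegral => t _; rewrite (min_idPl _). Qed.

Lemma capped_ge0 v : 0 <= v -> 0 <= capped f v.
Proof. by move=> v0; apply: Rintegral_ge0 => t _; rewrite le_min f0. Qed.

Lemma capped_le v : capped f v <= v.
Proof.
rewrite -[leRHS]Rintegral_cst01; apply: ler_Rintegral01 => //.
  exact: bounded_mfun_cst.
by move=> t; rewrite ge_min lexx orbT.
Qed.

Lemma capped_le_int v : capped f v <= \int[mu]_(t in I) f t.
Proof. by apply: ler_Rintegral01 => // t; rewrite ge_min lexx. Qed.

(** This is the lower Fréchet-Hoeffding bound; pointwise, [v + f - 1] is below [min(f, v)] because
    [f] and [v] are at most 1. *)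
Lemma capped_ge v : v <= 1 -> v + \int[mu]_(t in I) f t - 1 <= capped f v.
Proof.
move=> v1; rewrite -{1}[v]Rintegral_cst01 -[X in _ - X <= _]Rintegral_cst01.
rewrite -Rintegral01D//; last exact: bounded_mfun_cst.
have bD : bounded_mfun (fun t => v + f t).
  by apply: boundedD => //; exact: bounded_mfun_cst.
rewrite -Rintegral01B//; last exact: bounded_mfun_cst.
apply: ler_Rintegral01 => //.
  by apply: boundedB => //; exact: bounded_mfun_cst.
by move=> t; rewrite le_min; apply/andP; split; have := f1 t; lra.
Qed.

(** The bound holds under the integral sign: where [f > s] the right-hand integrand is [v],
    elsewhere it is [f], and both dominate [min(f, v)]. *)
Lemma capped_supergradient s v : capped f v <= capped f s + tail f s * (v - s).
Proof.
rewrite -Rintegral01Zr// -Rintegral01D//; last first.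
  by apply: boundedM => //; exact: bounded_mfun_cst.
apply: ler_Rintegral01 => //.
  by apply: boundedD => //; apply: boundedM => //; exact: bounded_mfun_cst.
move=> t; rewrite indicE; have [sf|sf] := boolP (t \in _).
  move: sf; rewrite inE/= => /ltW/min_idPr ->; rewrite mul1r subrKC.
  by rewrite ge_min lexx orbT.
rewrite mul0r addr0; move: sf; rewrite notin_setE/= => /negP.
by rewrite -leNgt => /min_idPl ->; rewrite ge_min lexx.
Qed.

Lemma tail01 s : 0 <= tail f s <= 1.
Proof.
apply/andP; split; first by apply: Rintegral_ge0 => t _; rewrite indicE.
rewrite -[leRHS]Rintegral_cst01; apply: ler_Rintegral01 => //.
  exact: bounded_mfun_cst.
Qed.

Lemma tail_nonincreasing s s' : s <= s' -> tail f s' <= tail f s.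
Proof.
move=> ss; apply: ler_Rintegral01 => // t; rewrite !indicE.
have [|//] := boolP (t \in [set t | s' < f t]).
by rewrite inE/= => /(le_lt_trans ss) h; rewrite mem_set.
Qed.

Lemma capped_contract g v : unit_fun g ->
  `|capped f v - capped g v| <= \int[mu]_(t in I) `|f t - g t|.
Proof.
move=> ug; have bg := unit_bounded ug.
have bming : bounded_mfun (fun t => Num.min (g t) v).
  by apply: bounded_min => //; exact: bounded_mfun_cst.
rewrite -Rintegral01B//; apply: le_trans (norm_Rintegral01 _) _.
  exact: boundedB.
apply: ler_Rintegral01; do ?[apply: bounded_norm; exact: boundedB].
move=> t; rewrite /Num.min; have := ler_norm (f t - g t).
have := ler_norm (g t - f t); rewrite distrC ler_norml => h1 h2.
by case: (ltP (f t) v) => ?; case: (ltP (g t) v) => ?; apply/andP; split; lra.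
Qed.

(* min is 2-increasing: for a <= b and v <= v',
   min(b,v') - min(a,v') - min(b,v) + min(a,v) >= 0. *)
Lemma capped_2increasing g v v' : unit_fun g ->
  {ae mu, forall t, 0 <= t <= 1 -> f t <= g t} -> v <= v' ->
  0 <= capped g v' - capped g v - capped f v' + capped f v.
Proof.
move=> ug fg vv; have bg := unit_bounded ug.
have bming w : bounded_mfun (fun t => Num.min (g t) w).
  by apply: bounded_min => //; exact: bounded_mfun_cst.
have -> : capped g v' - capped g v - capped f v' + capped f v =
  (capped g v' - capped g v) - (capped f v' - capped f v) by ring.
rewrite subr_ge0 -!Rintegral01B//.
apply: le_Rintegral01; do ?[exact: boundedB].
apply: filterS fg => t /[apply]; rewrite /Num.min.
by do ![case: ifPn => //]; rewrite -?leNgt; lra.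
Qed.

End bounded_functions.

(** * The operator T on copulas *)

Section copulas.
Context {R : realType}.
Notation mu := (@lebesgue_measure R).
Notation I := (@I01 R).
Implicit Types (C : R -> R -> R) (f G : R -> R) (u v s t : R).

Lemma in01_0 : 0 <= (0 : R) <= 1. Proof. by rewrite lexx ler01. Qed.
Lemma in01_1 : 0 <= (1 : R) <= 1. Proof. by rewrite lexx ler01. Qed.
#[local] Hint Resolve in01_0 in01_1 : core.

Lemma copula_lip2 C u v v' : is_copula C -> 0 <= u <= 1 ->
  0 <= v -> v <= v' -> v' <= 1 -> 0 <= C u v' - C u v <= v' - v.
Proof.
move=> [C0 C1 C2] /andP[u0 u1] v0 vv v1.
have v01 : 0 <= v <= 1 by rewrite v0 (le_trans vv).
have v01' : 0 <= v' <= 1 by rewrite v1 (le_trans v0).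
have := C2 0 u v v' (lexx 0) u0 u1 v0 vv v1.
have := C2 u 1 v v' u0 u1 (lexx 1) v0 vv v1.
have [_ ->] := C0 v v01; have [_ ->] := C0 v' v01'.
have [_ ->] := C1 v v01; have [_ ->] := C1 v' v01'.
by move=> h1 h2; apply/andP; split; lra.
Qed.

Lemma copula_lip1 C u u' v : is_copula C -> 0 <= v <= 1 ->
  0 <= u -> u <= u' -> u' <= 1 -> 0 <= C u' v - C u v <= u' - u.
Proof.
move=> [C0 C1 C2] /andP[v0 v1] u0 uu u1.
have u01 : 0 <= u <= 1 by rewrite u0 (le_trans uu).
have u01' : 0 <= u' <= 1 by rewrite u1 (le_trans u0).
have := C2 u u' 0 v u0 uu u1 (lexx 0) v0 v1.
have := C2 u u' v 1 u0 uu u1 v0 v1 (lexx 1).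
have [-> _] := C0 u u01; have [-> _] := C0 u' u01'.
have [-> _] := C1 u u01; have [-> _] := C1 u' u01'.
by move=> h1 h2; apply/andP; split; lra.
Qed.

Lemma copula_density C u : is_copula C -> 0 <= u <= 1 ->
  exists f, is_density (C u) f.
Proof.
by move=> cC u01; apply: density_exists => x y; exact: copula_lip2.
Qed.

Lemma density_Rintegral (F : R -> R) f : is_density F f ->
  \int[mu]_(t in I) f t = F 1 - F 0.
Proof. by move=> [_ + _] => ->. Qed.

Lemma d2_density C u f : is_density (C u) f ->
  {ae mu, forall t, 0 <= t <= 1 -> d2 C u t = f t}.
Proof.
by move=> [_ _ H]; apply: ae_unit_itv; apply: filterS H => t /[apply] -[].
Qed.

(** The section [s |-> v * s] of [Pi] has constant derivative [v], and [d2 C u] agrees with [f]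
    almost everywhere. *)
Lemma Top_capped C u f : is_density (C u) f -> Top C u = capped f.
Proof.
move=> df; apply/funext => v; congr fine; apply: ae_eq_integral_any.
apply: filterS (d2_density df) => t H; rewrite /I01/= in_itv/= => /H ->.
by rewrite /d2 (_ : (fun s => Pi v s) = *%R v)// derive1_scale.
Qed.

(** The rectangle inequality says that [C u' - C u] is nondecreasing, so right increments, and with
    them derivatives, are ordered. *)
Lemma density_le C u u' f f' : is_copula C -> 0 <= u -> u <= u' -> u' <= 1 ->
  is_density (C u) f -> is_density (C u') f' ->
  {ae mu, forall t, 0 <= t <= 1 -> f t <= f' t}.
Proof.
move=> cC u0 uu u1 [_ _ df] [_ _ df']; apply: ae_unit_itv.
apply: filterS2 df df' => t H H' t01.
have [dC <-] := H t01; have [dC' <-] := H' t01.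
case/andP: t01 => t0 t1; have t1' : 0 < 1 - t by rewrite subr_gt0.
apply: derive1_le => // d d0; have [h [h0 hd h1]] := small_pos d0 t1'.
exists h; split; [by rewrite gt_eqF|by rewrite gtr0_norm|].
rewrite ler_pM2l//; have [_ _ C2] := cC.
have th : t <= t + h by lra.
have th1 : t + h <= 1 by lra.
by have := C2 u u' t (t + h) u0 uu u1 (ltW t0) th th1; lra.
Qed.

(** The density of [C u] has total mass [u]. This gives the margin at [v = 1], forces the value 0 at
    [u = 0], and through [capped_ge] gives the margin at [u = 1]. The rectangle inequality comes
    from the monotonicity of densities in [u]. *)
Lemma Top_copula C : is_copula C -> is_copula (Top C).
Proof.
move=> cC; have [C0 C1 C2] := cC.
have D u : 0 <= u <= 1 -> exists2 f, is_density (C u) f & \int[mu]_(t in I) f t = u.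
  move=> u01; have [f df] := copula_density cC u01; exists f => //.
  rewrite (density_Rintegral df); have [-> _] := C0 u u01.
  by have [-> _] := C1 u u01; rewrite subr0.
split.
- move=> u u01; split.
    have [f df _] := D u u01; rewrite (Top_capped df) capped0//.
    by case: df.
  have [f df fi] := D 0 in01_0; rewrite (Top_capped df).
  have uf : unit_fun f by case: df.
  apply/eqP; rewrite eq_le capped_ge0 ?andbT; last 2 first.
  + by [].
  + by case/andP: u01.
  by rewrite -[leRHS]fi capped_le_int.
- move=> u u01; split.
    have [f df fi] := D u u01; rewrite (Top_capped df) capped1//.
    by case: df.
  have [f df fi] := D 1 in01_1; rewrite (Top_capped df).
  have uf : unit_fun f by case: df.
  have /andP[u0 u1] := u01.
  apply/eqP; rewrite eq_le capped_le//=.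
  by have := capped_ge uf u1; rewrite fi addrK.
- move=> u u' v v' u0 uu u1 v0 vv v1.
  have u01 : 0 <= u <= 1 by rewrite u0 (le_trans uu).
  have u01' : 0 <= u' <= 1 by rewrite u1 (le_trans u0).
  have [f df _] := D u u01; have [f' df' _] := D u' u01'.
  rewrite (Top_capped df) (Top_capped df').
  apply: capped_2increasing => //; [by case: df|by case: df'|].
  exact: density_le df df'.
Qed.

(** [tail f t] is a supergradient of [Top C u] at [t], hence its derivative wherever that exists. *)
Lemma Top_d2_tail C u f G : is_density (C u) f -> is_density (Top C u) G ->
  {ae mu, forall t, 0 <= t <= 1 -> G t = tail f t}.
Proof.
move=> df [_ _ dG]; apply: ae_unit_itv; apply: filterS dG => t H t01.
have [dT <-] := H t01; apply: (derive1_supergradient dT ltr01) => h _.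
rewrite (Top_capped df) lerBlDl; case: df => uf _ _.
by have := capped_supergradient uf t (t + h); rewrite [t + h - t]addrAC subrr add0r.
Qed.

(** * Conjugate duality between T and its square *)

Section duality.
Variables (C : R -> R -> R) (u : R).
Hypotheses (cC : is_copula C) (u01 : 0 <= u <= 1).

Let subS (A : set R) f : A `<=` I -> measurable A -> bounded_mfun f ->
  mu.-integrable A (EFin \o f).
Proof.
by move=> AI mA bf; apply: integrableS (bounded_integrable bf) => //; exact: measurable_itv.
Qed.

Let itvl s : s <= 1 -> `[0, s]%classic `<=` I.
Proof. by move=> s1 x; rewrite /I01 /= !in_itv/= => /andP[-> /le_trans]; apply. Qed.

Let itvr s : 0 <= s -> `]s, 1]%classic `<=` I.
Proof. by move=> s0 x; rewrite /I01 /= !in_itv/= => /andP[/ltW /(le_trans s0) ->]. Qed.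

(** Cutting at [s] separates the piece where [min(G, v)] is compared with [v] from the piece where
    it is compared with [G]. *)
Let split_capped G s v : is_density (Top C u) G -> 0 <= s <= 1 ->
  [/\ Top2 C u v = \int[mu]_(t in `[0, s]) Num.min (G t) v +
                   \int[mu]_(t in `]s, 1]) Num.min (G t) v,
      \int[mu]_(t in `[0, s]) v = v * s &
      \int[mu]_(t in `]s, 1]) G t = u - Top C u s].
Proof.
move=> dG s01; have [uG iG _] := dG; have bG := unit_bounded uG.
have [s0 s1] := andP s01.
have [T0 T1 _] := Top_copula cC.
split.
- rewrite /Top2 (Top_capped dG) /capped (Rintegral_split (s := s))//.
  exact: (bounded_min bG (bounded_mfun_cst v)).
- rewrite Rintegral_cst//= lebesgue_measure_itv/= lte_fin.
  case: ifPn => [_|]; first by rewrite /= subr0.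
  by rewrite -leNgt => s0'; rewrite (_ : s = 0) ?mulr0//; lra.
- have := iG s s01; have := Rintegral_split bG s01.
  rewrite (density_Rintegral dG).
  have [-> _] := T0 u u01; have [-> _] := T1 u u01.
  lra.
Qed.

(* With phi := Top C u concave of slope G, Top2 C u v = u + min_s (v s - phi s):
   up to constants Top2 C u is the concave conjugate of Top C u. *)
Lemma Top_Top2_young s v : 0 <= s <= 1 -> Top C u s + Top2 C u v <= v * s + u.
Proof.
move=> s01; have [G dG] := copula_density (Top_copula cC) u01.
have [-> e1 e2] := split_capped v dG s01.
have [/unit_bounded bG _ _] := dG.
have bm : bounded_mfun (fun t => Num.min (G t) v).
  by apply: bounded_min => //; exact: bounded_mfun_cst.
have [s0 s1] := andP s01.
have : \int[mu]_(t in `[0, s]) Num.min (G t) v <= \int[mu]_(t in `[0, s]) v.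
  apply: le_Rintegral => //; try by apply: subS => //; exact: itvl.
    by apply: subS; [exact: itvl|by []|exact: bounded_mfun_cst].
  by move=> t _; rewrite ge_min lexx orbT.
have : \int[mu]_(t in `]s, 1]) Num.min (G t) v <= \int[mu]_(t in `]s, 1]) G t.
  apply: le_Rintegral => //; try by apply: subS => //; exact: itvr.
  by move=> t _; rewrite ge_min lexx.
rewrite e1 e2; lra.
Qed.

(** The optimal [v] is the supergradient [tail f s]. As [G] equals the nonincreasing [tail f] almost
    everywhere, [min(G, v)] is [v] on [0, s] and [G] on ]s, 1], so no loss occurs in Young's
    inequality. *)
Lemma Top_Top2_young_eq s : 0 <= s <= 1 ->
  exists2 v, 0 <= v <= 1 & Top C u s + Top2 C u v = v * s + u.
Proof.
move=> s01; have [G dG] := copula_density (Top_copula cC) u01.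
have [f df] := copula_density cC u01.
have uf : unit_fun f by case: df.
exists (tail f s); first exact: tail01.
have [-> e1 e2] := split_capped (tail f s) dG s01.
have GE := Top_d2_tail df dG.
have [s0 s1] := andP s01.
have -> : \int[mu]_(t in `[0, s]) Num.min (G t) (tail f s) =
          \int[mu]_(t in `[0, s]) (tail f s).
  congr fine; apply: ae_eq_integral_any; apply: filterS GE => t H.
  rewrite /= in_itv/= => /andP[t0 ts]; congr EFin; apply/min_idPr.
  by rewrite H ?t0 ?(le_trans ts)// tail_nonincreasing.
have -> : \int[mu]_(t in `]s, 1]) Num.min (G t) (tail f s) =
          \int[mu]_(t in `]s, 1]) G t.
  congr fine; apply: ae_eq_integral_any; apply: filterS GE => t H.
  rewrite /= in_itv/= => /andP[ts t1]; congr EFin; apply/min_idPl.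
  by rewrite H ?t1 ?(le_trans s0 (ltW ts))// tail_nonincreasing// ltW.
rewrite e1 e2; lra.
Qed.

End duality.

(** Subtraction gives [b - a <= p - p'] and [a - b <= q' - q]. *)
Lemma dual_gap (a b p p' q q' x y e : R) : a + p = x -> b + p' <= x ->
  b + q' = y -> a + q <= y -> `|p - p'| < e -> `|q - q'| < e -> `|a - b| < e.
Proof.
rewrite !ltr_norml => h1 h2 h3 h4 /andP[h5 h6] /andP[h7 h8].
by apply/andP; split; lra.
Qed.

(** The level optimal for one copula is inserted into Young's inequality for the other, and
    conversely. *)
Lemma Top_dist_le_Top2 C D u s e : is_copula C -> is_copula D -> 0 <= u <= 1 ->
  0 <= s <= 1 -> (forall v, 0 <= v <= 1 -> `|Top2 C u v - Top2 D u v| < e) ->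
  `|Top C u s - Top D u s| < e.
Proof.
move=> cC cD u01 s01 H.
have [v v01 vE] := Top_Top2_young_eq cC u01 s01.
have [w w01 wE] := Top_Top2_young_eq cD u01 s01.
exact: dual_gap vE (Top_Top2_young cD u01 v s01) wE (Top_Top2_young cC u01 w s01)
  (H v v01) (H w w01).
Qed.

End copulas.

(** * Modes of convergence and the implications between them *)

Section convergence.
Context {R : realType}.
Notation mu := (@lebesgue_measure R).
Notation I := (@I01 R).
Implicit Types (C D : R -> R -> R) (f g F G : R -> R) (u v s t : R).

Lemma Rintegral_EFin f : bounded_mfun f ->
  (\int[mu]_(t in I) f t)%:E = (\int[mu]_(t in I) (f t)%:E)%E.
Proof.
move=> bf; rewrite fineK//; apply: integrable_fin_num.
  exact: measurable_I01.
exact: bounded_integrable.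
Qed.

Lemma d2_dist_density C D u f g : is_density (C u) f -> is_density (D u) g ->
  d2_dist C D u = (\int[mu]_(t in I) `|f t - g t|)%:E.
Proof.
move=> df dg.
have [uf _ _] := df; have [ug _ _] := dg.
rewrite Rintegral_EFin; last first.
  by apply: bounded_norm; apply: boundedB; exact: unit_bounded.
rewrite /d2_dist; apply: ae_eq_integral_any.
apply: filterS2 (d2_density df) (d2_density dg) => t H1 H2.
by rewrite /I01/= in_itv/= => t01; rewrite H1// H2.
Qed.

(** Both sections vanish at 0, so their difference at [v] is the integral of [f - g] over [0, v]. *)
Lemma copula_le_d2_dist C D u v : is_copula C -> is_copula D ->
  0 <= u <= 1 -> 0 <= v <= 1 -> (`|C u v - D u v|%:E <= d2_dist C D u)%E.
Proof.
move=> cC cD u01 v01.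
have [f df] := copula_density cC u01; have [g dg] := copula_density cD u01.
rewrite (d2_dist_density df dg) lee_fin.
have [uf fi _] := df; have [ug gi _] := dg.
have bB : bounded_mfun (fun t => f t - g t).
  by apply: boundedB; exact: unit_bounded.
have [C0 _ _] := cC; have [D0 _ _] := cD.
have /= := fi v v01; have /= := gi v v01.
have [-> _] := C0 u u01; have [-> _] := D0 u u01; rewrite !subr0 => -> ->.
have v1 : v <= 1 by case/andP: v01.
have sub : `[0, v]%classic `<=` I.
  by move=> x; rewrite /I01 /= !in_itv/= => /andP[-> /le_trans]; apply.
have ints h : bounded_mfun h -> mu.-integrable `[0, v]%classic (EFin \o h).
  move=> bh; apply: integrableS (bounded_integrable bh) => //.
  exact: measurable_I01.
rewrite -RintegralB//; [|exact: ints (unit_bounded _)..].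
apply: le_trans (le_normr_Rintegral _ (ints _ bB)) _ => //.
rewrite (Rintegral_split (bounded_norm bB) v01) lerDl.
by apply: Rintegral_ge0.
Qed.

Lemma Top_le_d2_dist C D u v : is_copula C -> is_copula D ->
  0 <= u <= 1 -> (`|Top C u v - Top D u v|%:E <= d2_dist C D u)%E.
Proof.
move=> cC cD u01.
have [f df] := copula_density cC u01; have [g dg] := copula_density cD u01.
rewrite (d2_dist_density df dg) lee_fin (Top_capped df) (Top_capped dg).
by apply: capped_contract; [case: df|case: dg].
Qed.

Definition pointwise_cvg (C_ : nat -> R -> R -> R) C := forall u v,
  0 <= u <= 1 -> 0 <= v <= 1 -> (fun n => C_ n u v) @ \oo --> C u v.

Lemma cvg_le_ereal (a : nat -> R) (l : R) (x : nat -> \bar R) :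
  (forall n, (`|a n - l|%:E <= x n)%E) -> x @ \oo --> 0%E -> a @ \oo --> l.
Proof.
move=> ax /fine_cvgP[xfin /cvgrPdist_lt x0]; apply/cvgrPdist_lt => e e0.
have := x0 e e0; apply: filterS2 xfin => n xn.
rewrite sub0r normrN /= distrC; apply: le_lt_trans.
by apply: le_trans (ler_norm _); rewrite -lee_fin fineK.
Qed.

Lemma d2_cvg_pointwise (C_ : nat -> R -> R -> R) C :
  (forall n, is_copula (C_ n)) -> is_copula C ->
  d2_cvg C_ C -> pointwise_cvg C_ C.
Proof.
move=> cC_ cC H u v u01 v01; apply: cvg_le_ereal (H u u01) => n.
exact: copula_le_d2_dist.
Qed.

Lemma d2_cvg_Top_pointwise (C_ : nat -> R -> R -> R) C :
  (forall n, is_copula (C_ n)) -> is_copula C ->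
  d2_cvg C_ C -> pointwise_cvg (fun n => Top (C_ n)) (Top C).
Proof.
move=> cC_ cC H u v u01 v01; apply: cvg_le_ereal (H u u01) => n.
exact: Top_le_d2_dist.
Qed.

(** The inequality at [t + h] and [t - h] traps [s_ n] between two difference quotients of [F_ n];
    for fixed small [h] these approach those of [F]. *)
Lemma supergradient_cvg (F_ : nat -> R -> R) F (s_ : nat -> R) t :
  0 < t < 1 -> derivable F t 1 ->
  (forall v, 0 <= v <= 1 -> (fun n => F_ n v) @ \oo --> F v) ->
  (forall n v, F_ n v <= F_ n t + s_ n * (v - t)) ->
  s_ @ \oo --> derive1 F t.
Proof.
move=> /andP[t0 t1] dF cF sg; apply/cvgrPdist_lt => e e0.
(* On each side one share of [e / 4 * h] pays for the first-order error of [F] and two for replacing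
   [F_ n] by [F] at two points. *)
have e4 : 0 < e / 4 by rewrite divr_gt0.
have [d d0 dH] := derivable_eps dF e4.
have t1' : 0 < 1 - t by rewrite subr_gt0.
have [d' [d'0 d't d't1]] := small_pos t0 t1'.
have [h [h0 hd hd']] := small_pos d0 d'0.
have eh : 0 < e / 4 * h by rewrite mulr_gt0.
have := dH h; rewrite gtr0_norm// => /(_ hd).
have := dH (- h); rewrite normrN gtr0_norm// => /(_ hd).
rewrite !ler_norml => /andP[L _] /andP[U _].
have r1 : 0 <= t + h <= 1 by apply/andP; split; lra.
have r2 : 0 <= t - h <= 1 by apply/andP; split; lra.
have r3 : 0 <= t <= 1 by apply/andP; split; lra.
have /cvgrPdist_lt/(_ _ eh) c1 := cF _ r1.
have /cvgrPdist_lt/(_ _ eh) c2 := cF _ r2.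
have /cvgrPdist_lt/(_ _ eh) c3 := cF _ r3.
near=> n.
have : `|F (t + h) - F_ n (t + h)| < e / 4 * h by near: n.
have : `|F (t - h) - F_ n (t - h)| < e / 4 * h by near: n.
have : `|F t - F_ n t| < e / 4 * h by near: n.
have := sg n (t + h); have := sg n (t - h).
have -> : s_ n * (t + h - t) = s_ n * h by ring.
have -> : s_ n * (t - h - t) = - (s_ n * h) by ring.
move=> S1 S2; rewrite !ltr_norml => /andP[a1 a2] /andP[b1 b2] /andP[k1 k2].
have : - (e * h) < (derive1 F t - s_ n) * h < e * h.
  rewrite mulrBl; move: L U; rewrite mulrN.
  have -> : e * h = 4 * (e / 4 * h) by field.
  by move=> L U; apply/andP; split; lra.
by rewrite -mulNr !ltr_pM2r.
Unshelve. all: by end_near. Qed.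

(** Almost everywhere the densities of [Top (C_ n) u] are supergradients, so [supergradient_cvg]
    makes them converge; dominated convergence with bound 1 yields the L1 statement. *)
Lemma pointwise_Top_d2_cvg (C_ : nat -> R -> R -> R) C :
  (forall n, is_copula (C_ n)) -> is_copula C ->
  pointwise_cvg (fun n => Top (C_ n)) (Top C) ->
  d2_cvg (fun n => Top (C_ n)) (Top C).
Proof.
move=> cC_ cC H u u01.
have /choice[f_ df_] : forall n, exists f, is_density (C_ n u) f.
  by move=> n; exact: copula_density.
have /choice[G_ dG_] : forall n, exists G, is_density (Top (C_ n) u) G.
  by move=> n; apply: copula_density => //; exact: Top_copula.
have [G dG] := copula_density (Top_copula cC) u01.
have uG_ n : unit_fun (G_ n) by case: (dG_ n).
have uG : unit_fun G by case: dG.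
have aeG : {ae mu, forall t, 0 <= t <= 1 -> (fun n => G_ n t) @ \oo --> G t}.
  (* A countable union of null sets is null, so one exceptional set serves all [n]. *)
  have ae1 : {ae mu, forall t, forall n, 0 <= t <= 1 -> G_ n t = tail (f_ n) t}.
    by apply/ae_foralln => n; exact: Top_d2_tail (df_ n) (dG_ n).
  apply: ae_unit_itv; have [_ _ ae2] := dG.
  apply: filterS2 ae1 ae2 => t E1 E2 t01.
  have [dT <-] := E2 t01; have [t0 t1] := andP t01.
  rewrite (_ : (fun n => G_ n t) = fun n => tail (f_ n) t); last first.
    by apply/funext => n; rewrite E1// !ltW.
  apply: (supergradient_cvg (F_ := fun n => Top (C_ n) u) t01 dT).
    by move=> v v01; exact: H.
  move=> n v; rewrite (Top_capped (df_ n)); apply: capped_supergradient.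
  by case: (df_ n).
have := @dominated_convergence _ _ R mu I (measurable_I01 (R := R))
  (fun n t => (G_ n t)%:E) (fun t => (G t)%:E) (cst 1%:E).
case.
- by move=> n; apply/measurable_EFinP/measurable_funTS; case: (uG_ n).
- by apply/measurable_EFinP/measurable_funTS; case: uG.
- apply: filterS aeG => t Ht; rewrite /I01/= in_itv/= => /Ht Gt.
  by apply: cvg_EFin => //; exact: nearW.
- exact: (bounded_integrable (bounded_mfun_cst (1 : R))).
- apply: nearW => t n _ /=; rewrite lee_fin.
  by have /andP[h1 h2] := (uG_ n).2 t; rewrite ger0_norm.
move=> _ A _; apply: cvg_trans A; apply: near_eq_cvg; apply: nearW => n /=.
rewrite (d2_dist_density (dG_ n) dG).
rewrite Rintegral_EFin//.
by apply: bounded_norm; apply: boundedB; exact: unit_bounded.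
Qed.

Lemma unif_cvg_pointwise (C_ : nat -> R -> R -> R) C : unif_cvg C_ C -> pointwise_cvg C_ C.
Proof.
move=> H u v u01 v01; apply/cvgrPdist_lt => e /H[N HN].
by exists N => // n /= Nn; rewrite distrC HN.
Qed.

Lemma copula_grid C u v p q d : is_copula C -> 0 <= p <= u -> u <= 1 -> u <= p + d ->
  0 <= q <= v -> v <= 1 -> v <= q + d -> 0 <= C u v - C p q <= 2 * d.
Proof.
move=> cC /andP[p0 pu] u1 ud /andP[q0 qv] v1 vd.
have v01 : 0 <= v <= 1 by rewrite v1 (le_trans q0).
have p01 : 0 <= p <= 1 by rewrite p0 (le_trans pu).
have /andP[h1 h2] := copula_lip1 cC v01 p0 pu u1.
have /andP[h3 h4] := copula_lip2 cC p01 q0 qv v1.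
by apply/andP; split; lra.
Qed.

Lemma grid_gap (a a' b b' d e : R) : 6 * d < e -> 0 <= a - a' <= 2 * d ->
  0 <= b - b' <= 2 * d -> `|a' - b'| < d -> `|a - b| < e.
Proof.
rewrite !ltr_norml => h /andP[h1 h2] /andP[h3 h4] /andP[h5 h6].
by apply/andP; split; lra.
Qed.

(** Copulas are monotone and 1-Lipschitz in each argument, so convergence at the finitely many nodes
    of a fine grid controls the whole square. *)
Lemma pointwise_unif_cvg (C_ : nat -> R -> R -> R) C :
  (forall n, is_copula (C_ n)) -> is_copula C ->
  pointwise_cvg C_ C -> unif_cvg C_ C.
Proof.
move=> cC_ cC H e e0.
(* With mesh [1 / m], the two copulas each vary by at most [2 / m] within a cell and differ by less
   than [1 / m] at its lower corner; the total stays below [6 / m < e]. *)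
pose m := (Num.truncn (6 / e)).+1.
have m0 : 0 < (m%:R : R) by rewrite ltr0n.
have em : 6 / e < m%:R.
  by apply: truncnS_gt.
have d6 : 6 * m%:R^-1 < e.
  by rewrite ltr_pdivrMr// mulrC -ltr_pdivrMr.
have grid01 (i : 'I_m.+1) : 0 <= (i%:R / m%:R : R) <= 1.
  rewrite divr_ge0//= ler_pdivrMr// mul1r ler_nat.
  by rewrite -ltnS.
have : \forall n \near \oo, forall ij : 'I_m.+1 * 'I_m.+1,
    `|C_ n (ij.1%:R / m%:R) (ij.2%:R / m%:R) -
      C (ij.1%:R / m%:R) (ij.2%:R / m%:R)| < m%:R^-1.
  apply: filter_forall => -[i j] /=.
  have /cvgrPdist_lt := H _ _ (grid01 i) (grid01 j).
  move=> /(_ m%:R^-1); rewrite invr_gt0 => /(_ m0).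
  by apply: filterS => n; rewrite distrC.
move=> [N _ HN]; exists N => n Nn u v u01 v01.
have cell (w : R) : 0 <= w <= 1 -> exists i : 'I_m.+1,
    0 <= (i%:R / m%:R : R) <= w /\ w <= i%:R / m%:R + m%:R^-1.
  move=> /andP[w0 w1]; have wm : 0 <= w * m%:R by rewrite mulr_ge0// ltW.
  have /andP[l r] := truncn_itv wm.
  (* The index [m] itself is reached when [w = 1], hence [m + 1] nodes per axis. *)
  have im : (Num.truncn (w * m%:R) < m.+1)%N.
    rewrite ltnS -(ler_nat R); apply: le_trans l _.
    by rewrite ler_piMl// ltW.
  exists (Ordinal im) => /=; split.
    by rewrite divr_ge0//= ler_pdivrMr.
  by rewrite -[X in _ + X]mul1r -mulrDl ler_pdivlMr// natr1 ltW.
have [i [ui ui']] := cell u u01; have [j [vj vj']] := cell v v01.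
have [_ u1] := andP u01; have [_ v1] := andP v01.
exact: grid_gap d6 (copula_grid (cC_ n) ui u1 ui' vj v1 vj')
  (copula_grid cC ui u1 ui' vj v1 vj') (HN n Nn (i, j)).
Qed.

End convergence.

Theorem mainTheorem18 (R : realType) (Dn : nat -> R -> R -> R) (D : R -> R -> R) :
  (forall n, is_copula (Dn n)) -> is_copula D ->
  (d2_cvg Dn D -> d2_cvg (fun n => Top (Dn n)) (Top D)) /\
  (d2_cvg (fun n => Top (Dn n)) (Top D) <-> unif_cvg (fun n => Top (Dn n)) (Top D)) /\
  (d2_cvg (fun n => Top (Dn n)) (Top D) <-> d2_cvg (fun n => Top2 (Dn n)) (Top2 D)) /\
  (d2_cvg (fun n => Top (Dn n)) (Top D) <-> unif_cvg (fun n => Top2 (Dn n)) (Top2 D)).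
Proof.
(* This and the next fact are stated for arbitrary copulas: they are applied to [Dn] and again to
   [Top (Dn n)], because [Top2] is [Top] of [Top]. *)
have i_ii (C_ : nat -> R -> R -> R) C :
    (forall n, is_copula (C_ n)) -> is_copula C ->
    d2_cvg C_ C -> d2_cvg (fun n => Top (C_ n)) (Top C).
  move=> cC_ cC /(d2_cvg_Top_pointwise cC_ cC).
  exact: pointwise_Top_d2_cvg.
have ii_iii (C_ : nat -> R -> R -> R) C :
    (forall n, is_copula (C_ n)) -> is_copula C ->
    d2_cvg (fun n => Top (C_ n)) (Top C) <-> unif_cvg (fun n => Top (C_ n)) (Top C).
  move=> cC_ cC.
  have cT_ n : is_copula (Top (C_ n)) by exact: Top_copula.
  have cT : is_copula (Top C) by exact: Top_copula.
  split; first by move=> /(d2_cvg_pointwise cT_ cT); exact: pointwise_unif_cvg.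
  by move=> /unif_cvg_pointwise; exact: pointwise_Top_d2_cvg.
move=> cD_ cD.
have cT_ n : is_copula (Top (Dn n)) by exact: Top_copula.
have cT : is_copula (Top D) by exact: Top_copula.
(* Duality provides the way back from the square of T to T, with the same rank [N]. *)
have v_iii : unif_cvg (fun n => Top2 (Dn n)) (Top2 D) ->
    unif_cvg (fun n => Top (Dn n)) (Top D).
  move=> H e e0; have [N HN] := H e e0; exists N => n Nn u s u01 s01.
  exact: (Top_dist_le_Top2 (cD_ n) cD u01 s01
    (fun v v01 => HN n Nn u v u01 v01)).
have [ii_to_iii iii_to_ii] := ii_iii _ _ cD_ cD.
have [iv_to_v v_to_iv] := ii_iii _ _ cT_ cT.
have ii_to_iv := i_ii _ _ cT_ cT.
split; first exact: i_ii.
split; first exact: (conj ii_to_iii iii_to_ii).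
split; [apply: (conj ii_to_iv)|apply: (conj (fun h => iv_to_v (ii_to_iv h)))].
  by move=> h; exact: (iii_to_ii (v_iii (iv_to_v h))).
by move=> h; exact: (iii_to_ii (v_iii h)).
Qed.
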